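(* Let $\Lambda$ be a finite dimensional algebra over a field, $k\ge1$ an integer and $M$ a right $\Lambda$-module. Then $k\text{-}\operatorname{edell}M\le k\text{-}\operatorname{dell}M$.
   Context: Modules are right $\Lambda$-modules; $\mathrm{mod}\,\Lambda$ denotes the finitely generated ones. $\mathbb N$ is the set of nonnegative integers; the infimum of the empty set is $+\infty$. $\Omega M$ is the kernel of a projective cover of $M$, $\Omega^0M=M$, $\Omega^{n+1}M=\Omega(\Omega^nM)$. ''$A$ is a direct summand of $B$ up to projective summands'' means that $A$ is isomorphic to a direct summand of $B\oplus P$ for some projective $P$. $k\text{-}\operatorname{dell}M$ is the infimum of all $n\in\mathbb N$ such that $\Omega^nM$ is a direct summand of $\Omega^{n+k}N$ up to projective summands for some $N\in\mathrm{mod}\,\Lambda$. $k\text{-}\operatorname{edell}M$ is the infimum of all $n\in\mathbb N$ such that for every integer $k'\ge1$ and every right $\Lambda$-module $X$ of injective dimension $\mathrm{id}\,X=n+k-1+k'$ one has $\mathrm{Ext}_\Lambda^{n+k'}(M,X)=0$. *)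

(* Defs.v *)
From HB Require Import structures.
From mathcomp Require Import all_boot all_order all_algebra all_field.
From mathcomp Require Import boolp classical_sets constructive_ereal.

Set Implicit Arguments.
Unset Strict Implicit.
Unset Printing Implicit Defensive.

Import Order.TTheory GRing.Theory Num.Theory.
Local Open Scope ring_scope.

(** Values in N with +oo adjoined are taken in [\bar int], so that the order is
    the library's; the infimum of the empty set is [+oo]. *)
Definition nat_inf (S : nat -> Prop) : \bar int :=
  if pselect (exists n, `[< S n >]) is left h
  then (Posz (ex_minn h))%:E else +oo%E.

(** Everything below is stated for left modules over a ring [R].  Right modules
    over an algebra [L] are the case [R := L^c] (the opposite ring). *)

Definition surj_lin (R : pzRingType) (A B : lmodType R)
    (f : {linear A -> B}) : Prop :=
  forall y, exists x, f x = y.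

Definition exact_at (R : pzRingType) (A B C : lmodType R)
    (f : {linear A -> B}) (g : {linear B -> C}) : Prop :=
  forall y, g y = 0 <-> exists x, f x = y.

Definition module_iso (R : pzRingType) (A B : lmodType R) : Prop :=
  exists f : {linear A -> B}, bijective f.

Definition fin_gen (R : pzRingType) (N : lmodType R) : Prop :=
  exists (m : nat) (e : 'I_m -> N),
    forall x, exists c : 'I_m -> R, x = \sum_(i < m) c i *: e i.

Definition projective (R : pzRingType) (P : lmodType R) : Prop :=
  forall (A B : lmodType R) (g : {linear A -> B}) (f : {linear P -> B}),
    surj_lin g -> exists h : {linear P -> A}, forall x, g (h x) = f x.

Definition injective_module (R : pzRingType) (I : lmodType R) : Prop :=
  forall (A B : lmodType R) (g : {linear A -> B}) (f : {linear A -> I}),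
    injective g -> exists h : {linear B -> I}, forall x, h (g x) = f x.

Definition projective_cover (R : pzRingType) (M P : lmodType R)
    (p : {linear P -> M}) : Prop :=
  [/\ projective P, surj_lin p &
      forall (A : lmodType R) (f : {linear A -> P}),
        (forall y, exists x, p (f x) = y) -> surj_lin f].

(** Syzygies are only determined up to isomorphism: [is_Omega M K] says that
    [K] is (isomorphic to) the kernel of a projective cover of [M]. *)
Definition is_Omega (R : pzRingType) (M K : lmodType R) : Prop :=
  exists (P : lmodType R) (p : {linear P -> M}) (i : {linear K -> P}),
    [/\ projective_cover p, injective i & exact_at i p].

Fixpoint is_syzygy (R : pzRingType) (n : nat) (M K : lmodType R) : Prop :=
  match n with
  | 0 => module_iso M K
  | n'.+1 => exists L : lmodType R, is_syzygy n' M L /\ is_Omega L K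
  end.

Definition direct_summand (R : pzRingType) (A B : lmodType R) : Prop :=
  exists C : lmodType R, module_iso (A * C)%type B.

Definition stable_summand (R : pzRingType) (A B : lmodType R) : Prop :=
  exists P : lmodType R, projective P /\ direct_summand A (B * P)%type.

Record proj_resolution (R : pzRingType) (M : lmodType R) := ProjResolution {
  pr_obj : nat -> lmodType R;
  pr_d : forall i, {linear pr_obj i.+1 -> pr_obj i};
  pr_aug : {linear pr_obj 0%N -> M};
  pr_proj : forall i, projective (pr_obj i);
  pr_aug_surj : surj_lin pr_aug;
  pr_exact0 : exact_at (pr_d 0%N) pr_aug;
  pr_exact : forall i, exact_at (pr_d i.+1) (pr_d i) }.

Definition is_cocycle (R : pzRingType) (M : lmodType R)
    (Q : proj_resolution M) (X : lmodType R) (n : nat)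
    (f : {linear pr_obj Q n -> X}) : Prop :=
  forall x, f (pr_d Q n x) = 0.

Definition is_coboundary (R : pzRingType) (M : lmodType R)
    (Q : proj_resolution M) (X : lmodType R) (n : nat) :
    {linear pr_obj Q n -> X} -> Prop :=
  match n return {linear pr_obj Q n -> X} -> Prop with
  | 0 => fun f => forall x, f x = 0
  | m.+1 => fun f =>
      exists g : {linear pr_obj Q m -> X}, forall x, f x = g (pr_d Q m x)
  end.

(** Ext^n(M, X) = 0, where Ext^n(M, X) is the n-th cohomology group of
    Hom(Q, X) for a projective resolution Q of M.  Resolutions exist (by free
    modules) and this group does not depend on Q up to isomorphism. *)
Definition Ext_eq0 (R : pzRingType) (n : nat) (M X : lmodType R) : Prop :=
  forall (Q : proj_resolution M) (f : {linear pr_obj Q n -> X}),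
    is_cocycle f -> is_coboundary f.

Record inj_resolution (R : pzRingType) (X : lmodType R) := InjResolution {
  ir_obj : nat -> lmodType R;
  ir_d : forall i, {linear ir_obj i -> ir_obj i.+1};
  ir_aug : {linear X -> ir_obj 0%N};
  ir_inj : forall i, injective_module (ir_obj i);
  ir_aug_inj : injective ir_aug;
  ir_exact0 : exact_at ir_aug (ir_d 0%N);
  ir_exact : forall i, exact_at (ir_d i) (ir_d i.+1) }.

Definition inj_dim (R : pzRingType) (X : lmodType R) : \bar int :=
  nat_inf (fun m => exists J : inj_resolution X,
    forall i, (m < i)%N -> forall x : ir_obj J i, x = 0).

Definition dell (R : pzRingType) (k : nat) (M : lmodType R) : \bar int :=
  nat_inf (fun n => exists N K L : lmodType R,
    [/\ fin_gen N, is_syzygy n M K, is_syzygy (n + k) N L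
      & stable_summand K L]).

Definition edell (R : pzRingType) (k : nat) (M : lmodType R) : \bar int :=
  nat_inf (fun n => forall (k' : nat) (X : lmodType R), (1 <= k')%N ->
    inj_dim X = (Posz (n + k - 1 + k'))%:E -> Ext_eq0 (n + k') M X).

(* Main.v *)
Require Import Defs.
From mathcomp Require Import all_boot all_order all_algebra all_field.
From mathcomp Require Import boolp classical_sets constructive_ereal.
From HB Require Import structures.

(** For an injective resolution [J] of [X], the group Ext^j(A, X) is also the
    j-th cohomology of Hom(A, J), which does not mention any projective
    resolution of [A].  In this form Ext^(j+1)(A, X) = 0 iff
    Ext^j(Omega A, X) = 0 for [j >= 1], and vanishing passes to stable summands.
    If [K = Omega^n M] is a stable summand of [L = Omega^(n+k) N], then
    Ext^(n+k+k')(N, X) = 0 because the injective dimension of [X] is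
    [n + k - 1 + k'], hence Ext^k'(L, X) = 0, hence Ext^k'(K, X) = 0, hence
    Ext^(n+k')(M, X) = 0. *)

Set Implicit Arguments.
Unset Strict Implicit.
Unset Printing Implicit Defensive.

Import Order.TTheory GRing.Theory Num.Theory.
Local Open Scope ring_scope.

Lemma nat_inf_le (S T : nat -> Prop) :
  (forall n, T n -> S n) -> (nat_inf S <= nat_inf T)%E.
Proof.
move=> TS; rewrite /nat_inf.
case: (pselect (exists n, `[< T n >])) => [hT|_]; last by rewrite leey.
case: pselect => [hS|nS]; last first.
  by case: nS; case: hT => n /asboolP /TS Sn; exists n; apply/asboolP.
case: ex_minnP => m _ minS; case: ex_minnP => n /asboolP Tn _.
by rewrite lee_fin lez_nat minS //; apply/asboolP/TS.
Qed.

Lemma nat_inf_attained (S : nat -> Prop) (m : nat) :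
  nat_inf S = (Posz m)%:E -> S m.
Proof.
rewrite /nat_inf; case: pselect => // hS.
by case: ex_minnP => n /asboolP Sn _ [<-].
Qed.

Section Kernel.
Variables (R : pzRingType) (A B : lmodType R) (g : {linear A -> B}).

Definition ker_pred : {pred A} := fun x => g x == 0.

Fact ker_pred_submod : submod_closed ker_pred.
Proof.
split=> [|a x y]; first by rewrite unfold_in /ker_pred linear0.
rewrite !unfold_in /ker_pred => /eqP gx /eqP gy.
by rewrite linearP gx gy scaler0 addr0.
Qed.

HB.instance Definition _ := GRing.isSubmodClosed.Build R A ker_pred
  ker_pred_submod.

Record ker_mod := KerMod { ker_val : A; _ : ker_val \in ker_pred }.

HB.instance Definition _ := [isSub for ker_val].
HB.instance Definition _ := [Choice of ker_mod by <:].
HB.instance Definition _ := [SubChoice_isSubLmodule of ker_mod by <:].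

Definition ker_incl : {linear ker_mod -> A} := \val.

Lemma ker_incl_inj : injective ker_incl.
Proof. exact: val_inj. Qed.

Lemma ker_inclP : exact_at ker_incl g.
Proof.
move=> y; split=> [/eqP gy|[x <-]]; first by exists (KerMod gy).
exact/eqP/(valP x).
Qed.

Lemma ker_corestrict (C : lmodType R) (f : {linear C -> A}) :
  (forall x, g (f x) = 0) ->
  exists f' : {linear C -> ker_mod}, forall x, ker_incl (f' x) = f x.
Proof.
move=> gf0.
have kf x : f x \in ker_pred by apply/eqP.
pose h x := KerMod (kf x).
have h_lin : linear h by move=> a x y; apply: val_inj; rewrite /= linearP.
pose hL := GRing.isLinear.Build _ _ _ _ h h_lin.
by exists (HB.pack h hL : {linear C -> ker_mod}).
Qed.

End Kernel.

Section Ext.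
Variable R : pzRingType.
Implicit Types A B C D E K L M N P X : lmodType R.

Lemma factor_surj A B C (p : {linear A -> B}) (f : {linear A -> C}) :
  surj_lin p -> (forall x, p x = 0 -> f x = 0) ->
  exists h : {linear B -> C}, forall x, h (p x) = f x.
Proof.
move=> /boolp.choice [s sK] pf.
have fE x y : p x = p y -> f x = f y.
  move=> pxy; apply/eqP; rewrite -subr_eq0 -linearB; apply/eqP/pf.
  by rewrite linearB pxy subrr.
pose h := f \o s.
have h_lin : linear h.
  by move=> a x y; rewrite /h /= -linearP; apply: fE; rewrite linearP !sK.
pose hL := GRing.isLinear.Build _ _ _ _ h h_lin.
by exists (HB.pack h hL : {linear B -> C}) => x; apply: fE; rewrite sK.
Qed.

Lemma projective_lift P A B C (f : {linear A -> B}) (g : {linear B -> C})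
    (u : {linear P -> B}) :
  projective P -> exact_at f g -> (forall x, g (u x) = 0) ->
  exists h : {linear P -> A}, forall x, f (h x) = u x.
Proof.
move=> projP fg gu0.
have gf0 x : g (f x) = 0 by apply/fg; exists x.
have [f' f'E] := ker_corestrict gf0; have [u' u'E] := ker_corestrict gu0.
have f'_surj : surj_lin f'.
  move=> y; have /fg [x fx] : g (ker_incl g y) = 0 by apply/ker_inclP; exists y.
  by exists x; apply: ker_incl_inj; rewrite f'E.
have [h hE] := projP _ _ f' u' f'_surj.
by exists h => x; rewrite -f'E hE u'E.
Qed.

Definition factors_cycles A B C D (f : {linear B -> C}) (g : {linear C -> D}) :=
  forall u : {linear A -> C}, (forall x, g (u x) = 0) ->
    exists h : {linear A -> B}, forall x, f (h x) = u x.

Section DimensionShift.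
Variables (K P A : lmodType R) (i : {linear K -> P}) (p : {linear P -> A}).
Hypotheses (projP : projective P) (i_inj : injective i).
Hypotheses (ip : exact_at i p) (p_surj : surj_lin p).
Variables (I0 I1 I2 I3 : lmodType R) (d0 : {linear I0 -> I1}).
Variables (d1 : {linear I1 -> I2}) (d2 : {linear I2 -> I3}).
Hypotheses (d01 : exact_at d0 d1) (d12 : exact_at d1 d2).

Lemma shift_to_syzygy (u : {linear K -> I1}) :
  injective_module I1 -> factors_cycles A d1 d2 -> (forall x, d1 (u x) = 0) ->
  exists t : {linear P -> I0}, forall x, d0 (t (i x)) = u x.
Proof.
move=> injI1 cA d1u.
have pi0 x : p (i x) = 0 by apply/ip; exists x.
have [v vE] := injI1 _ _ i u i_inj.
have [w wE] : exists w : {linear A -> I2}, forall x, w (p x) = d1 (v x).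
  by apply: (factor_surj (f := d1 \o v)) => // x /ip [y <-] /=; rewrite vE.
have [x|h hE] := cA w.
  by have [y <-] := p_surj x; rewrite wE; apply/d12; exists (v y).
have [x|t tE] := projective_lift (u := v \- (h \o p)) projP d01.
  by rewrite /= linearB hE wE subrr.
by exists t => x; rewrite tE /= pi0 linear0 subr0 vE.
Qed.

Lemma shift_from_syzygy :
  injective_module I0 -> factors_cycles K d0 d1 -> factors_cycles A d1 d2.
Proof.
move=> injI0 cK w d2w.
have pi0 x : p (i x) = 0 by apply/ip; exists x.
have [x|v vE] := projective_lift (u := w \o p) projP d12; first exact: d2w.
have [x|u uE] := cK (v \o i); first by rewrite /= vE /= pi0 linear0.
have [s sE] := injI0 _ _ i u i_inj.
have [x /ip [y <-]|h hE] := factor_surj (f := v \- (d0 \o s)) p_surj.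
  by rewrite /= sE uE subrr.
exists h => x; have [y <-] := p_surj x; rewrite hE /= linearB vE /=.
suff -> : d1 (d0 (s y)) = 0 by rewrite subr0.
by apply/d01; exists (s y).
Qed.

End DimensionShift.

Lemma factors_cycles_retract A B (s : {linear A -> B}) (r : {linear B -> A})
    C D E (f : {linear C -> D}) (g : {linear D -> E}) :
  cancel s r -> factors_cycles B f g -> factors_cycles A f g.
Proof.
move=> sK cB u gu0; have [x|h hE] := cB (u \o r); first exact: gu0.
by exists (h \o s) => x; rewrite /= hE /= sK.
Qed.

Lemma factors_cycles_iso A B C D E (f : {linear C -> D}) (g : {linear D -> E}) :
  module_iso A B -> factors_cycles A f g <-> factors_cycles B f g.
Proof.
move=> [s [r sK rK]].
have r_lin : linear r.
  by move=> a x y; rewrite -[in LHS](rK x) -[in LHS](rK y) -linearP sK.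
pose rL := GRing.isLinear.Build _ _ _ _ r r_lin.
pose r' : {linear B -> A} := HB.pack r rL.
by split; [apply: (@factors_cycles_retract _ _ r' s)
          |apply: (@factors_cycles_retract _ _ s r')].
Qed.

Lemma pair_left_linear A B : linear (fun a : A => (a, 0 : B)).
Proof. by move=> c x y; congr pair; rewrite /= scaler0 addr0. Qed.

Lemma pair_right_linear A B : linear (fun b : B => (0 : A, b)).
Proof. by move=> c x y; congr pair; rewrite /= scaler0 addr0. Qed.

Definition pair_left A B : {linear A -> (A * B)%type} :=
  HB.pack (fun a : A => (a, 0 : B))
    (GRing.isLinear.Build _ _ _ _ _ (@pair_left_linear A B)).

Definition pair_right A B : {linear B -> (A * B)%type} :=
  HB.pack (fun b : B => (0 : A, b))
    (GRing.isLinear.Build _ _ _ _ _ (@pair_right_linear A B)).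

Lemma factors_cycles_prod A B C D E (f : {linear C -> D})
    (g : {linear D -> E}) :
  factors_cycles A f g -> factors_cycles B f g ->
  factors_cycles (A * B)%type f g.
Proof.
move=> cA cB u gu0.
have [x|h hE] := cA (u \o @pair_left A B); first exact: gu0.
have [x|t tE] := cB (u \o @pair_right A B); first exact: gu0.
exists ((h \o fst) \+ (t \o snd)) => -[x y] /=.
rewrite linearD hE tE /= -linearD; congr (u _).
by congr pair; rewrite /= ?addr0 ?add0r.
Qed.

Lemma factors_cycles_stable_summand K L C D E (f : {linear C -> D})
    (g : {linear D -> E}) :
  exact_at f g -> stable_summand K L ->
  factors_cycles L f g -> factors_cycles K f g.
Proof.
move=> fg [P [projP [Q isoQ]]] cL.
apply: (@factors_cycles_retract _ _ (@pair_left K Q) fst) => //.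
apply/(factors_cycles_iso _ _ isoQ)/factors_cycles_prod => // u.
exact: projective_lift.
Qed.

Lemma first_syzygy_cover M (Q : proj_resolution M) :
  exists e : {linear pr_obj Q 1 -> ker_mod (pr_aug Q)},
    surj_lin e /\ forall x, ker_incl _ (e x) = pr_d Q 0 x.
Proof.
have d_aug x : pr_aug Q (pr_d Q 0 x) = 0 by apply/pr_exact0; exists x.
have [e eE] := ker_corestrict d_aug; exists e; split=> // y.
have /pr_exact0 [x xE] : pr_aug Q (ker_incl _ y) = 0.
  by apply/ker_inclP; exists y.
by exists x; apply: ker_incl_inj; rewrite eE.
Qed.

Lemma first_syzygy_exact M (Q : proj_resolution M)
    (e : {linear pr_obj Q 1 -> ker_mod (pr_aug Q)}) :
  (forall x, ker_incl _ (e x) = pr_d Q 0 x) -> exact_at (pr_d Q 1) e.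
Proof.
move=> eE y; rewrite -(pr_exact y) -eE; split=> [->|]; first by rewrite linear0.
by rewrite -[RHS](linear0 (ker_incl (pr_aug Q))) => /ker_incl_inj.
Qed.

Definition shift_resolution M (Q : proj_resolution M)
    (e : {linear pr_obj Q 1 -> ker_mod (pr_aug Q)}) (e_surj : surj_lin e)
    (eE : forall x, ker_incl _ (e x) = pr_d Q 0 x) :=
  @ProjResolution _ _ (fun j => pr_obj Q j.+1) (fun j => pr_d Q j.+1) e
    (fun j => @pr_proj _ _ Q j.+1) e_surj (first_syzygy_exact eE)
    (fun j => @pr_exact _ _ Q j.+1).

Section Resolution.
Variables (X : lmodType R) (J : inj_resolution X).

(** [Ext_inj0 j A] says that Ext^(j+1)(A, X) = 0. *)
Definition Ext_inj0 (j : nat) A := factors_cycles A (ir_d J j) (ir_d J j.+1).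

Lemma Ext_inj0_Omega j A K :
  is_Omega A K -> Ext_inj0 j.+1 A <-> Ext_inj0 j K.
Proof.
move=> [P [p [i [[projP p_surj _] i_inj ip]]]]; split=> [cA u du|cK].
  have [t tE] := shift_to_syzygy projP i_inj ip p_surj (@ir_exact _ _ J j)
    (@ir_exact _ _ J j.+1) (@ir_inj _ _ J j.+1) cA du.
  by exists (t \o i).
exact: (shift_from_syzygy projP i_inj ip p_surj (@ir_exact _ _ J j)
  (@ir_exact _ _ J j.+1) (@ir_inj _ _ J j) cK).
Qed.

Lemma Ext_inj0_syzygy n j A K :
  is_syzygy n A K -> Ext_inj0 (n + j) A <-> Ext_inj0 j K.
Proof.
elim: n j K => [|n IHn] j K; first exact: factors_cycles_iso.
by move=> [L [/IHn AL /Ext_inj0_Omega LK]]; rewrite addSnnS AL LK.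
Qed.

Lemma Ext_inj0_vanish j A :
  (forall x : ir_obj J j.+1, x = 0) -> Ext_inj0 j A.
Proof.
move=> J0 u _; exists (\0) => x.
by rewrite [RHS]J0 [LHS]J0.
Qed.

Lemma Ext_inj0_Ext_eq0 j M : Ext_inj0 j M -> Ext_eq0 j.+1 M X.
Proof.
elim: j M => [|j IHj] M cM Q f f_cocycle;
  have [e [e_surj eE]] := first_syzygy_cover Q.
  have [x|u uE] := factor_surj (f := f) e_surj.
    move=> ex0; have /pr_exact [y <-] : pr_d Q 0 x = 0 by rewrite -eE ex0 linear0.
    exact: f_cocycle.
  have du x : ir_d J 0 ((ir_aug J \o u) x) = 0 by apply/ir_exact0; exists (u x).
  have [t tE] := shift_to_syzygy (@pr_proj _ _ Q 0) (@ker_incl_inj _ _ _ _)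
    (@ker_inclP _ _ _ _) (@pr_aug_surj _ _ Q) (@ir_exact0 _ _ J)
    (@ir_exact _ _ J 0) (@ir_inj _ _ J 0) cM du.
  by exists t => x; rewrite -uE -eE; apply: (@ir_aug_inj _ _ J); rewrite tE.
have cK : Ext_inj0 j (ker_mod (pr_aug Q)).
  move=> u du.
  have [t tE] := shift_to_syzygy (@pr_proj _ _ Q 0) (@ker_incl_inj _ _ _ _)
    (@ker_inclP _ _ _ _) (@pr_aug_surj _ _ Q) (@ir_exact _ _ J j)
    (@ir_exact _ _ J j.+1) (@ir_inj _ _ J j.+1) cM du.
  by exists (t \o ker_incl _).
exact: (IHj _ cK (shift_resolution e_surj eE) f f_cocycle).
Qed.

End Resolution.

Lemma Ext_eq0_of_stable_summand k n k' (M N K L X : lmodType R) :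
  (1 <= k)%N -> (1 <= k')%N ->
  is_syzygy n M K -> is_syzygy (n + k) N L -> stable_summand K L ->
  inj_dim X = (Posz (n + k - 1 + k'))%:E -> Ext_eq0 (n + k') M X.
Proof.
case: k k' => [|k] [|k'] // _ _ MK NL KL /nat_inf_attained [J J0].
rewrite addnS; apply: (@Ext_inj0_Ext_eq0 _ J).
apply/(Ext_inj0_syzygy _ _ MK).
apply: (factors_cycles_stable_summand (@ir_exact _ _ J k') KL).
apply/(Ext_inj0_syzygy _ _ NL)/Ext_inj0_vanish/J0.
by rewrite addnS subn1 /= addnS addSn.
Qed.

End Ext.

Unset Implicit Arguments.

Theorem lemma2p10 (F : fieldType) (Lambda : falgType F) (k : nat)
    (hk : (1 <= k)%N) (M : lmodType (Lambda^c)%type) :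
  (edell k M <= dell k M)%E.
Proof.
apply: nat_inf_le => n [N [K [L [_ MK NL KL]]]] k' X k'1.
exact: (Ext_eq0_of_stable_summand hk k'1 MK NL KL).
Qed.
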